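(* Let $\varphi:U^{\mathrm{trop}}(\mathbb{Q})\to\mathbb{Q}$ be convex with respect to broken lines, and let $r\in\mathbb{Q}$. Then $$\Xi_{\varphi,r}:=\{x\in U^{\mathrm{trop}}(\mathbb{Q}) : \varphi(x)\geq -r\}$$ is broken line convex.
   Context: Setting. All intervals are intervals in $\mathbb{Q}$. $U$ and $U^\vee$ are mirror (Fock–Goncharov dual) cluster varieties for which the full Fock–Goncharov conjecture holds (in the sense of Gross–Hacking–Keel–Kontsevich, GHKK); roughly, the integral tropical points of each parametrize the theta basis of regular functions on the other. Each seed $\mathbf{s}$ gives a piecewise linear identification $\mathfrak{r}_{\mathbf{s}}:U^{\mathrm{trop}}(\mathbb{Q})\to V:=L\otimes\mathbb{Q}$ carrying $U^{\mathrm{trop}}(\mathbb{Z})$ to $L$, where $L$ is the cocharacter lattice of the seed torus in $U$. Scattering diagram. In a seed $\mathbf{s}$, the GHKK cluster scattering diagram $\mathfrak{D}$ of $U^\vee$ is a collection of walls $(\mathfrak{d},f_{\mathfrak{d}})$ in $V$: $\mathfrak{d}$ is a codimension-one rational polyhedral cone and $f_{\mathfrak{d}}$ is a series $1+\sum_{k\geq1}c_kz^{km_{\mathfrak{d}}}$ in a completed monoid ring, $m_{\mathfrak{d}}\in L\setminus\{0\}$ tangent to $\mathfrak{d}$. It is a colimit $\mathfrak{D}=\operatorname{colim}_k\mathfrak{D}_k$ of finite scattering diagrams. Crossing a wall with velocity $v$ acts by $z^m\mapsto z^m f_{\mathfrak{d}}^{n(m)}$, where $n$ is the primitive normal to $\mathfrak{d}$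 with $n(v)<0$. $\operatorname{Sing}(\mathfrak{D}_k)$ is the union of the boundaries of walls and of intersections of walls of codimension $\ge2$. Mutation invariance makes $U^{\mathrm{trop}}(\mathbb{Q})$ the seed-independent ambient space of $\mathfrak{D}$. Broken lines. A $k$-generic broken line with initial exponent $m\in L\setminus\{0\}$ and endpoint $x_0\in V\setminus\operatorname{supp}(\mathfrak{D}_k)$ is a piecewise linear continuous proper path $\gamma:\mathbb{Q}_{\le0}\to V\setminus\operatorname{Sing}(\mathfrak{D}_k)$, with finitely many domains of linearity $\ell$, bending only at walls of $\mathfrak{D}_k$, with a monomial $c_\ell z^{m_\ell}$ attached to each $\ell$, such that $\gamma(0)=x_0$; the unbounded domain carries $z^m$; $\dot\gamma=-m_\ell$ on $\ell$; and at a bend from $\ell$ to $\ell'$, $c_{\ell'}z^{m_{\ell'}}$ is a term of the image of $c_\ell z^{m_\ell}$ under the wall-crossing automorphism of the walls through the bending point. A broken line with initial exponent $m$ and endpoint $x_0\in V$ is a piecewise linear continuous proper path $\gamma:\mathbb{Q}_{\le0}\to V$ with a sequence $(\gamma_k)$ of $k$-generic broken lines of initial exponent $m$ whose supports converge to the image of $\gamma$ and which, for $k$ large, all bend at the same walls in the same order with the same monomials. A broken line segment $\gamma:[t_1,t_2]\to U^{\mathrm{trop}}(\mathbb{Q})$ is the restriction of a broken line to a finite interval (up to translating time; constant paths are allowed); its endpoints are $\gamma(t_1),\gamma(t_2)$ and its support is its image. Convexity. $S\subset U^{\mathrm{trop}}(\mathbb{Q})$ is broken line convex if for all $s_1,s_2\in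 S$, every broken line segment with endpoints $s_1,s_2$ has support contained in $S$. For such $S$ (e.g. $S=U^{\mathrm{trop}}(\mathbb{Q})$), $\varphi:S\to\mathbb{Q}$ is convex with respect to broken lines if for every broken line segment $\gamma:[t_1,t_2]\to S$ and all $t\in[t_1,t_2]$, $$\varphi(\gamma(t))\geq\Big(\tfrac{t_2-t}{t_2-t_1}\Big)\varphi(\gamma(t_1))+\Big(\tfrac{t-t_1}{t_2-t_1}\Big)\varphi(\gamma(t_2)).$$ *)

(* Defs.v *)
(* Mathematical Components world. *)
From HB Require Import structures.
From Stdlib Require List.
From mathcomp Require Import all_boot all_order all_algebra.
From mathcomp Require Import boolp classical_sets.

Set Implicit Arguments.
Unset Strict Implicit.
Unset Printing Implicit Defensive.

Import Order.TTheory GRing.Theory Num.Theory.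
Local Open Scope ring_scope.

(* L = Z^n is 'rV[int]_n; its dual L^* is again 'rV[int]_n, in dual coordinates.
   V = L (x) Q is 'rV[rat]_n. *)
Definition pair (R : realDomainType) n (h : 'rV[int]_n) (x : 'rV[R]_n) : R :=
  \sum_i (h 0 i)%:~R * x 0 i.

Definition emb (R : realDomainType) n (m : 'rV[int]_n) : 'rV[R]_n :=
  map_mx (fun z : int => z%:~R) m.

Definition content n (h : 'rV[int]_n) : nat :=
  \big[gcdn/0%N]_(j < n) `|h ord0 j|%N.

Definition primitive_part n (h : 'rV[int]_n) : 'rV[int]_n :=
  \row_j (h ord0 j %/ Posz (content h))%Z.

(* ------------------------------------------------------------------------ *)
(* Cluster varieties                                                        *)
(* ------------------------------------------------------------------------ *)

(* A seed of the cluster variety U^vee whose seed tori have character lattice L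
   (so L is the cocharacter lattice of the seed tori of U).  The r mutable
   directions are numbered by 'I_r.  Row k of [cvec] is c_k in L, row k of
   [hvec] is h_k in L^*, and mutation in direction k glues seed tori along
      mu_k^* z^m = z^m (1 + z^{c_k})^{- h_k(m)}.
   For fixed data (N, {,}, d_i) and a seed (e_i):
     - U^vee = A : L = M^o, c_k = {e_k, .}, h_k = d_k e_k in N^o;
     - U^vee = X : L = N,   c_k = e_k,      h_k = {., d_k e_k} in N^*.
   In both cases h_j(c_i) = {e_i, e_j} d_j is the exchange matrix. *)
Record seed (n r : nat) := Seed {
  cvec : 'M[int]_(r, n);
  hvec : 'M[int]_(r, n);
  dmul : 'I_r -> nat }.

Definition exch n r (S : seed n r) : 'M[int]_r := cvec S *m (hvec S)^T.

(* The two alternatives say that the h_k (resp. the c_k) are part of a basis of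
   L^* (resp. L), i.e. that U^vee is of type A (resp. X). *)
Definition cluster_seed n r (S : seed n r) : Prop :=
  [/\ forall i, (0 < dmul S i)%N,
      forall i j, exch S i j *+ dmul S i = - (exch S j i *+ dmul S j)
    & (exists K : 'M[int]_(n, r), hvec S *m K = 1%:M) \/
      (exists K : 'M[int]_(n, r), cvec S *m K = 1%:M)].

(* Fock-Goncharov (Langlands) dual: N^o replaces N, d_i e_i replaces e_i and
   lcm(d) / d_i replaces d_i.  This exchanges types A and X. *)
Definition dual_seed n r (S : seed n r) : seed n r :=
  Seed (hvec S) (- cvec S)
       (fun i => (\big[lcmn/1%N]_(j < r) dmul S j %/ dmul S i)%N).

(* e_i' = e_i + [eps_ik]_+ e_k for i != k, and e_k' = - e_k, transported to the
   vectors c_i and h_i. *)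
Definition mutate n r (S : seed n r) (k : 'I_r) : seed n r :=
  Seed (\matrix_(i < r) if i == k then - row k (cvec S)
          else row i (cvec S) + Num.max 0 (exch S i k) *: row k (cvec S))
       (\matrix_(i < r) if i == k then - row k (hvec S)
          else row i (hvec S) + Num.max 0 (- exch S k i) *: row k (hvec S))
       (dmul S).

(* Seeds are the vertices of the rooted tree of mutation words. *)
Definition seed_at n r (S : seed n r) (w : seq 'I_r) : seed n r :=
  foldl (@mutate n r) S w.

(* The tropicalized mutation of U. *)
Definition trop_mut (R : realDomainType) n r (S : seed n r) (k : 'I_r)
    (x : 'rV[R]_n) : 'rV[R]_n :=
  x + Num.max 0 (pair (row k (hvec S)) x) *: emb R (row k (cvec S)).

(* U^trop(Q) for R = rat, U^trop(Z) for R = int: the charts of all seed tori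
   of U glued along the tropicalized mutations.  [chart x w] is r_s(x) for the
   seed s at w. *)
Record trop (R : realDomainType) n r (S : seed n r) := Trop {
  chart : seq 'I_r -> 'rV[R]_n;
  chartP : forall w k, chart (rcons w k) = trop_mut (seed_at S w) k (chart w) }.

(* ------------------------------------------------------------------------ *)
(* Scattering diagrams                                                      *)
(* ------------------------------------------------------------------------ *)

(* Elements of the monoid N_uf^+ generated by the e_i, i in 'I_r. *)
Definition degvec (r : nat) : Type := {ffun 'I_r -> nat}.
HB.instance Definition _ r := Equality.on (degvec r).

Definition deg r (a : degvec r) : nat := \sum_i a i.

Definition cexp n r (S : seed n r) (a : degvec r) : 'rV[int]_n :=
  \sum_i row i (cvec S) *+ a i.

(* The wall with support
     { x | <w_normal, x> = 0 and <a, x> >= 0 for all a in w_ineqs },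
   and function 1 + sum_{j >= 1} (w_fun j) z^{j m}, where m = cexp S w_dir.
   The series lives in the ring completed by the degree in N_uf^+, where
   z^{c_i} has degree e_i. *)
Record wall (n r : nat) := Wall {
  w_dir : degvec r;
  w_normal : 'rV[int]_n;
  w_ineqs : seq 'rV[int]_n;
  w_fun : nat -> rat }.

Definition on_wall n r (w : wall n r) (x : 'rV[rat]_n) : bool :=
  (pair (w_normal w) x == 0) && all (fun a => 0 <= pair a x) (w_ineqs w).

Definition supp n r (W : seq (wall n r)) (x : 'rV[rat]_n) : bool :=
  has (fun w => on_wall w x) W.

Definition codim_ge2 n (A : 'rV[rat]_n -> Prop) : Prop :=
  exists a b : 'rV[rat]_n, row_free (col_mx a b) /\
    forall x, A x -> a *m x^T = 0 /\ b *m x^T = 0.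

(* Relative boundary in the hyperplane orthogonal to the normal. *)
Definition wall_boundary n r (w : wall n r) (x : 'rV[rat]_n) : Prop :=
  on_wall w x /\ exists y, pair (w_normal w) y = 0 /\
    forall e : rat, 0 < e -> ~~ on_wall w (x + e *: y).

Definition Sing n r (W : seq (wall n r)) (x : 'rV[rat]_n) : Prop :=
  (exists w, List.In w W /\ wall_boundary w x) \/
  (exists w1 w2, [/\ List.In w1 W, List.In w2 W, on_wall w1 x, on_wall w2 x
     & codim_ge2 (fun y => on_wall w1 y && on_wall w2 y)]).

(* For n0 = sum_i (w_dir w i) e_i in N_uf^+, the left-hand side of the third
   condition is n0 itself in type A and {., n0} in type X. *)
Definition is_wall n r (S : seed n r) (w : wall n r) : Prop :=
  [/\ \big[gcdn/0%N]_i w_dir w i = 1%N,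
      content (w_normal w) = 1%N,
      exists2 l : rat, l != 0 &
        \sum_i ((w_dir w i)%:R / (dmul S i)%:R) *: emb rat (row i (hvec S))
          = l *: emb rat (w_normal w),
      ~ codim_ge2 (on_wall w)
    & w_fun w 0%N = 1 /\ cexp S (w_dir w) != 0].

(* The generator m of the exponents is not in the support. *)
Definition outgoing n r (S : seed n r) (w : wall n r) : Prop :=
  ~~ on_wall w (emb rat (cexp S (w_dir w))).

(* d is the least degree in N_uf^+ of a nonconstant term of the function. *)
Definition has_order n r (w : wall n r) (d : nat) : Prop :=
  exists j, [/\ (0 < j)%N, w_fun w j != 0,
    forall l, (0 < l < j)%N -> w_fun w l = 0 & (j * deg (w_dir w))%N = d].

(* [D d] lists the walls of order exactly d, so that D_k, the walls which are
   nontrivial modulo degree > k, is finite and D = colim_k D_k. *)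
Definition diagram n r : Type := nat -> seq (wall n r).

Definition upto n r (D : diagram n r) (k : nat) : seq (wall n r) :=
  flatten [seq D d | d <- iota 0 k.+1].

Definition gbinom (p : int) (i : nat) : rat :=
  (\prod_(l < i) (p%:~R - l%:R)) / (i`!)%:R.

(* Coefficient of s^j in (1 + sum_{l >= 1} (f l) s^l)^p. *)
Definition pow_coef (f : nat -> rat) (p : int) (j : nat) : rat :=
  \sum_(i < j.+1)
    gbinom p i * ((\poly_(l < j.+1) (if l == 0%N then 0 else f l)) ^+ i)`_j.

(* A series sum_b (g b) z^{m + cexp S b}, graded by b, is represented by m and
   g.  The grading is kept even when the c_i are linearly dependent; this is
   the computation with principal coefficients. *)
Definition series r : Type := degvec r -> rat.

Definition one_series r : series r := fun b => (b == [ffun=> 0%N])%:R.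

(* Crossing w with velocity v: z^m |-> z^m f^{n(m)} with n = +- w_normal the
   primitive normal such that n(v) < 0. *)
Definition cross1 n r (S : seed n r) (v : 'rV[rat]_n) (m : 'rV[int]_n)
    (g : series r) (w : wall n r) : series r :=
  fun b => \sum_(j < (deg b).+1 | [forall i, (j * w_dir w i <= b i)%N])
    let b' : degvec r := [ffun i => (b i - j * w_dir w i)%N] in
    g b' * pow_coef (w_fun w)
             (- sgz (pair (w_normal w) v) * pair (w_normal w) (m + cexp S b')) j.

Definition cross n r (S : seed n r) (W : seq (wall n r)) (v : 'rV[rat]_n)
    (m : 'rV[int]_n) (g : series r) : series r :=
  foldl (cross1 S v m) g W.

Definition segm n (p q : 'rV[rat]_n) (t : rat) : 'rV[rat]_n := p + t *: (q - p).

(* A segment off the singular locus with end points off the support, crossing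
   the support at most once.  A generic polygonal path can be subdivided into
   such segments, and it crosses walls transversally. *)
Definition generic_step n r (W : seq (wall n r)) (p q : 'rV[rat]_n) : Prop :=
  [/\ ~~ supp W p, ~~ supp W q,
      forall t, 0 <= t <= 1 -> ~ Sing W (segm p q t)
    & forall t t', 0 <= t <= 1 -> 0 <= t' <= 1 ->
        supp W (segm p q t) -> supp W (segm p q t') -> t = t'].

Definition cross_step n r (S : seed n r) (W : seq (wall n r)) (p q : 'rV[rat]_n)
    (m : 'rV[int]_n) (g : series r) : series r :=
  cross S [seq w <- W | `[< exists t, 0 <= t <= 1 /\ on_wall w (segm p q t) >]]
        (q - p) m g.

(* Path-ordered products around generic loops are trivial to every order. *)
Definition consistent n r (S : seed n r) (D : diagram n r) : Prop :=
  forall (k N : nat) (p : nat -> 'rV[rat]_n),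
    p N = p 0%N ->
    (forall i, (i < N)%N -> generic_step (upto D k) (p i) (p i.+1)) ->
    forall (m : 'rV[int]_n) (b : degvec r), (deg b <= k)%N ->
      foldl (fun g i => cross_step S (upto D k) (p i) (p i.+1) m g)
            (@one_series r) (iota 0 N) b = one_series b.

(* The hyperplane orthogonal to h_i with function 1 + z^{c_i}; since z^m is
   sent to z^m (1 + z^{c_i})^{+- h_i(m)}, the function relative to the
   primitive normal is (1 + z^{c_i})^{content h_i}.  There is no wall when
   h_i = 0. *)
Definition initial_walls n r (S : seed n r) : seq (wall n r) :=
  [seq Wall [ffun j => nat_of_bool (j == i)]
            (primitive_part (row i (hvec S))) [::]
            (fun j => ('C(content (row i (hvec S)), j))%:R)
    | i <- enum 'I_r & row i (hvec S) != 0].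

(* The cluster scattering diagram of U^vee in the seed S, which is unique up to
   equivalence: consistent, all noninitial walls outgoing. *)
Definition is_cluster_diagram n r (S : seed n r) (D : diagram n r) : Prop :=
  [/\ List.Forall (is_wall S) (initial_walls S),
      forall d, exists out,
        D d = (if d == 1%N then initial_walls S else [::]) ++ out /\
        List.Forall (fun w => [/\ is_wall S w, outgoing S w & has_order w d]) out
    & consistent S D].

(* ------------------------------------------------------------------------ *)
(* Broken lines                                                             *)
(* ------------------------------------------------------------------------ *)

(* A bend: its time, the degree b in N_uf^+ of the term picked, and the monomial
   (c, m), meaning c z^m, attached to the domain of linearity that follows. *)
Definition bend n r : Type := (rat * degvec r * (rat * 'rV[int]_n))%type.

Definition times n r (bs : seq (bend n r)) : seq rat := [seq b.1.1 | b <- bs].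

Definition monos n r (m : 'rV[int]_n) (bs : seq (bend n r)) :
  seq (rat * 'rV[int]_n) := (1, m) :: [seq b.2 | b <- bs].

Definition bdeg n r (bs : seq (bend n r)) : nat := \sum_(b <- bs) deg b.1.2.

(* The i-th domain of linearity of a path on Q_{<= 0} with break times ts; the
   0-th one is unbounded, the last one ends at the default value 0 of nth. *)
Definition in_domain (ts : seq rat) (i : nat) (t : rat) : bool :=
  ((i == 0%N) || (nth 0 ts i.-1 <= t)) && (t <= nth 0 ts i).

(* The velocity is minus the exponent of the attached monomial.  The domains
   are closed, so this makes the path continuous and piecewise linear; it is
   proper when the initial exponent is nonzero. *)
Definition follows n (g : rat -> 'rV[rat]_n) (ts : seq rat)
    (ms : seq (rat * 'rV[int]_n)) : Prop :=
  forall i s t, (i <= size ts)%N -> in_domain ts i s -> in_domain ts i t ->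
    g t - g s = (s - t) *: emb rat (nth (0, 0) ms i).2.

(* c' z^m', with m' = m + cexp S b, is a term of the image of c z^m under the
   automorphism of the walls through x. *)
Definition is_term n r (S : seed n r) (W : seq (wall n r)) (x : 'rV[rat]_n)
    (cm cm' : rat * 'rV[int]_n) (b : degvec r) : Prop :=
  [/\ cm'.2 = cm.2 + cexp S b,
      cm'.1 = cm.1 * cross S [seq w <- W | on_wall w x] (- emb rat cm.2) cm.2
                       (@one_series r) b
    & cm'.1 != 0].

(* k-generic broken line g with initial exponent m and end point g 0.  The last
   condition expresses that monomials are taken modulo degree > k, as are the
   functions of D_k. *)
Definition generic_broken_line n r (S : seed n r) (D : diagram n r) (k : nat)
    (m : 'rV[int]_n) (g : rat -> 'rV[rat]_n) (bs : seq (bend n r)) : Prop :=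
  [/\ m != 0 /\ ~~ supp (upto D k) (g 0),
      forall t, t <= 0 -> ~ Sing (upto D k) (g t),
      sorted <%R (rcons (times bs) 0) /\ follows g (times bs) (monos m bs),
      forall i, (i < size bs)%N ->
        let b := nth (0, [ffun=> 0%N], (0, 0)) bs i in
        let cm := nth (0, 0) (monos m bs) i in
        b.2.2 <> cm.2 /\ is_term S (upto D k) (g b.1.1) cm b.2 b.1.2
    & (bdeg bs <= k)%N].

Definition close n (e : rat) (x y : 'rV[rat]_n) : Prop :=
  forall i, `|x 0 i - y 0 i| < e.

(* The supports of the gk converge to that of g.  Hausdorff distance is adequate
   despite unboundedness: the unbounded domains are parallel rays. *)
Definition supports_cvg n (gk : nat -> rat -> 'rV[rat]_n)
    (g : rat -> 'rV[rat]_n) : Prop :=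
  forall e : rat, 0 < e -> exists K, forall k, (K <= k)%N ->
    (forall t, t <= 0 -> exists2 t', t' <= 0 & close e (g t) (gk k t')) /\
    (forall t, t <= 0 -> exists2 t', t' <= 0 & close e (gk k t) (g t')).

(* For k large the gk bend at the same walls ws, in the same order, with the same
   monomials ms.  These are the monomials of g, which is parametrized by
   velocity minus exponent; domains of linearity may degenerate to points in
   the limit, hence the weak inequalities between its break times ts. *)
Definition broken_line n r (S : seed n r) (D : diagram n r) (m : 'rV[int]_n)
    (g : rat -> 'rV[rat]_n) : Prop :=
  exists (gk : nat -> rat -> 'rV[rat]_n) (bk : nat -> seq (bend n r))
         (ms : seq (rat * 'rV[int]_n)) (ws : seq (wall n r)) (ts : seq rat),
  [/\ forall k, generic_broken_line S D k m (gk k) (bk k),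
      supports_cvg gk g,
      exists K, forall k, (K <= k)%N ->
        [/\ monos m (bk k) = ms, size (bk k) = size ws
          & forall i w, List.nth_error ws i = Some w ->
              List.In w (upto D k) /\ on_wall w (gk k (nth 0 (times (bk k)) i))],
      size ms = (size ts).+1
    & sorted <=%R (rcons ts 0) /\ follows g ts ms].

(* ------------------------------------------------------------------------ *)
(* The full Fock-Goncharov conjecture                                       *)
(* ------------------------------------------------------------------------ *)

(* f = mu_k^* f' for Laurent polynomials given by their coefficients: where
   h_k(x) = p, f' = f (1 + z^{c_k})^p, i.e. f = f' (1 + z^{c_k})^{-p}; recall
   h_k(c_k) = 0. *)
Definition mut_related n r (S : seed n r) (k : 'I_r)
    (f f' : 'rV[int]_n -> rat) : Prop :=
  forall x, let p := pair (row k (hvec S)) x in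
    let shift (u : 'rV[int]_n -> rat) :=
      \sum_(j < `|p|%N.+1) ('C(`|p|%N, j))%:R * u (x - row k (cvec S) *+ j) in
    if 0 <= p then f' x = shift f else f x = shift f'.

(* Regular functions on U^vee: families of Laurent polynomials on all its seed
   tori, compatible with the gluing. *)
Definition regular n r (S : seed n r)
    (f : seq 'I_r -> 'rV[int]_n -> rat) : Prop :=
  (forall w, exists s : seq 'rV[int]_n, forall m, f w m != 0 -> m \in s) /\
  (forall w k, mut_related (seed_at S w) k (f w) (f (rcons w k))).

(* Principal coefficients.  The middle coordinates make the h_k part of a basis,
   so that the positive chamber has nonempty interior; the last ones do the same
   for the c_k. *)
Definition prin n r (S : seed n r) : seed (n + (r + r)) r :=
  Seed (row_mx (cvec S) (row_mx 0 1%:M)) (row_mx (hvec S) (row_mx 1%:M 0))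
       (dmul S).

(* The Laurent polynomial f on the seed torus of S is the expansion of the theta
   function of q: the sum of the final monomials of the broken lines with initial
   exponent q (finitely many: of degree at most K) ending at a general point Q of
   the positive chamber, with the principal coefficients set to 1.  As in the
   definition of broken lines, "general" is relative to the order k, and hs is a
   finite set of hyperplanes to be avoided. *)
Definition theta_expansion n r (S : seed n r) (q : 'rV[int]_n)
    (f : 'rV[int]_n -> rat) : Prop :=
  if q == 0 then forall m, f m = (m == 0)%:R else
  exists2 D, is_cluster_diagram (prin S) D &
  exists K : nat, forall k, (K <= k)%N ->
  exists2 hs : seq 'rV[int]_(n + (r + r)), 0 \notin hs &
  forall Q : 'rV[rat]_(n + (r + r)),
    (forall i, 0 < pair (row i (hvec (prin S))) Q) ->
    all (fun a => pair a Q != 0) hs ->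
  exists E : seq (seq (bend (n + (r + r)) r)),
    [/\ uniq E,
        forall bs, bs \in E <->
          exists2 g, g 0 = Q &
            generic_broken_line (prin S) D k (row_mx q 0) g bs,
        forall bs, bs \in E -> (bdeg bs <= K)%N
      & forall m, f m =
          \sum_(bs <- E | lsubmx (last (0, 0) (monos (row_mx q 0) bs)).2 == m)
             (last (0, 0) (monos (row_mx q 0) bs)).1].

(* For the cluster variety U^vee: every point of U^trop(Z) has a theta function,
   which is a regular function on U^vee, and the theta functions form a basis of
   the space of regular functions. *)
Definition full_FG n r (S : seed n r) : Prop :=
  exists theta : trop int S -> seq 'I_r -> 'rV[int]_n -> rat,
  [/\ forall q w, theta_expansion (seed_at S w) (chart q w) (theta q w),
      forall q, regular S (theta q),
      forall f, regular S f ->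
        exists (N : nat) (q : 'I_N -> trop int S) (a : 'I_N -> rat),
          forall w m, f w m = \sum_i a i * theta (q i) w m
    & forall (N : nat) (q : 'I_N -> trop int S) (a : 'I_N -> rat),
        injective q ->
        (forall w m, \sum_i a i * theta (q i) w m = 0) -> forall i, a i = 0].

(* ------------------------------------------------------------------------ *)
(* Broken line convexity                                                    *)
(* ------------------------------------------------------------------------ *)

Section Convexity.
Local Open Scope classical_set_scope.

(* A broken line segment on [t1, t2] in U^trop(Q), read in the chart of the seed
   at w, where D is the scattering diagram.  Only the values of g on [t1, t2]
   matter. *)
Definition broken_line_segment n r (S : seed n r) (w : seq 'I_r)
    (D : diagram n r) (t1 t2 : rat) (g : rat -> trop rat S) : Prop :=
  t1 <= t2 /\
  ((forall t, t1 <= t <= t2 -> g t = g t1) \/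
   exists (m : 'rV[int]_n) (b : rat -> 'rV[rat]_n) (s : rat),
     [/\ broken_line (seed_at S w) D m b, t2 + s <= 0
       & forall t, t1 <= t <= t2 -> chart (g t) w = b (t + s)]).

Definition broken_line_convex n r (S : seed n r) (w : seq 'I_r)
    (D : diagram n r) (A : set (trop rat S)) : Prop :=
  forall s1 s2, A s1 -> A s2 ->
  forall t1 t2 g, broken_line_segment w D t1 t2 g -> g t1 = s1 -> g t2 = s2 ->
  forall t, t1 <= t <= t2 -> A (g t).

(* To be used for a broken line convex set A; only the values of phi on A
   matter. *)
Definition convex_wrt_broken_lines n r (S : seed n r) (w : seq 'I_r)
    (D : diagram n r) (A : set (trop rat S)) (phi : trop rat S -> rat) : Prop :=
  forall t1 t2 g, t1 < t2 -> broken_line_segment w D t1 t2 g ->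
  (forall t, t1 <= t <= t2 -> A (g t)) ->
  forall t, t1 <= t <= t2 ->
    (t2 - t) / (t2 - t1) * phi (g t1) + (t - t1) / (t2 - t1) * phi (g t2)
      <= phi (g t).

Definition Xi n r (S : seed n r) (phi : trop rat S -> rat) (c : rat) :
  set (trop rat S) := [set x | - c <= phi x].

End Convexity.

(* Main.v *)
Require Import Defs.
From mathcomp Require Import all_boot all_order all_algebra.
From mathcomp Require Import boolp classical_sets.
From mathcomp Require Import ring.

Import Order.TTheory GRing.Theory Num.Theory.

Local Open Scope ring_scope.

(** Along a broken line segment, convexity bounds [phi] below by a weighted mean of its values at
    the two ends. Both values are at least [- c], and so is their mean by [le_barycenter]. *)

Lemma le_barycenter (R : realFieldType) (t1 t2 t a x y : R) :
  t1 < t2 -> t1 <= t <= t2 -> a <= x -> a <= y ->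
  a <= (t2 - t) / (t2 - t1) * x + (t - t1) / (t2 - t1) * y.
Proof.
move=> lt12 /andP[le1 le2] leax leay.
have d_gt0 : 0 < t2 - t1 by rewrite subr_gt0.
(* The weights sum to 1, so the comparison can be made term by term. *)
have -> : a = (t2 - t) / (t2 - t1) * a + (t - t1) / (t2 - t1) * a.
  by field; rewrite gt_eqF.
by apply: lerD; apply: ler_wpM2l => //; rewrite divr_ge0 ?subr_ge0 ?(ltW lt12).
Qed.

Theorem proposition41 (n r : nat) (S : seed n r) (hS : cluster_seed S)
    (hFGdual : full_FG S) (hFG : full_FG (dual_seed S))
    (w : seq 'I_r) (D : diagram n r)
    (hD : is_cluster_diagram (seed_at S w) D)
    (phi : trop rat S -> rat)
    (hphi : convex_wrt_broken_lines w D [set: trop rat S]%classic phi)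
    (c : rat) :
  broken_line_convex w D (Xi phi c).
Proof.
move=> s1 s2 As1 As2 t1 t2 g hg g1 g2 t ht.
(* The weights divide by [t2 - t1], so a segment reduced to one instant is treated apart. *)
have [lt12|le21] := ltP t1 t2; last first.
  have -> : t = t1.
    by case/andP: ht => le1 le2; apply/le_anti; rewrite le1 (le_trans le2 le21).
  by rewrite g1.
(* [phi] is convex on the whole space, so staying in its domain is trivial. *)
apply: le_trans (hphi t1 t2 g lt12 hg (fun _ _ => I) t ht).
by apply: le_barycenter => //; rewrite ?g1 ?g2.
Qed.
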